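(* Let $q$ and $q+2$ be odd prime powers and let $v=q(q+2)$. Then there is a $(v,2;\frac{v-1}{2},\frac{v+1}{2};\frac{v+1}{4},\frac{v+1}{4})$-GSEDF (in some abelian group of order $v$).
   Context: Let $G$ be a finite abelian group of order $v$, written additively with identity $0$. For disjoint subsets $A,B\subseteq G$, let $\Delta(A,B)$ be the multiset $\{x-y : x\in A, y\in B\}$. For positive integers $k_1,k_2,\lambda_1,\lambda_2$, a $(v,2;k_1,k_2;\lambda_1,\lambda_2)$-generalized strong external difference family (GSEDF) in $G$ is a pair $\{D_1,D_2\}$ of disjoint subsets of $G$ with $|D_1|=k_1$, $|D_2|=k_2$ such that $\Delta(D_1,D_2)$ contains every element of $G\setminus\{0\}$ exactly $\lambda_1$ times and $\Delta(D_2,D_1)$ contains every element of $G\setminus\{0\}$ exactly $\lambda_2$ times. *)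

(* Defs.v *)
From HB Require Import structures.
From mathcomp Require Import all_boot all_order all_algebra.

Set Implicit Arguments.
Unset Strict Implicit.
Unset Printing Implicit Defensive.

Import GRing.Theory.

Definition prime_power (q : nat) : Prop :=
  exists p k : nat, [/\ prime p, 0 < k & q = p ^ k].

(* The multiset of differences is a sequence considered up to permutation:
   the multiplicity of g is count_mem g (Delta A B). *)
Definition Delta (G : finZmodType) (A B : {set G}) : seq G :=
  [seq (x - y)%R | x <- enum A, y <- enum B].

Definition gsedf2 (v k1 k2 l1 l2 : nat) (G : finZmodType) (D1 D2 : {set G})
    : Prop :=
  [/\ [/\ 0 < k1, 0 < k2, 0 < l1 & 0 < l2],
      #|G| = v,
      [disjoint D1 & D2],
      #|D1| = k1 /\ #|D2| = k2 &
      forall g : G, g != 0%R ->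
        count_mem g (Delta D1 D2) = l1 /\ count_mem g (Delta D2 D1) = l2].

(* Main.v *)
(* The construction is the twin prime power difference set. On F x K, with
   #|F| = q and #|K| = q + 2, the function
     f (x, y) = chi x * chi y + [y = 0] - [x = 0] + [x = 0] [y = 0]
   takes values in {1, -1}; D1 is where it is 1 and D2 where it is -1. Since f
   is a sum of four product functions, its autocorrelation splits into products
   of autocorrelations on F and K. The mixed terms chi a * chi b cancel because
   exactly one of q, q + 2 is 1 mod 4, so that chi is even on one field and odd
   on the other. What is left is -1 off the origin, and the number of
   representations of g <> 0 as a difference is (v - (-1)) / 4. *)

From HB Require Import structures.
Require Import Defs.
From mathcomp Require Import all_boot all_order all_algebra all_fingroup.
From mathcomp Require Import all_solvable all_field.
From mathcomp Require Import ring zify.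

Set Implicit Arguments.
Unset Strict Implicit.
Unset Printing Implicit Defensive.

Import GRing.Theory.
Local Open Scope ring_scope.

(** * Quadratic character of a finite field of odd order *)

Section QuadraticCharacter.
Variable F : finFieldType.
Hypothesis oddF : odd #|F|.

Definition qchar (x : F) : int :=
  if x == 0 then 0 else if x ^+ #|F|./2 == 1 then 1 else -1.

Let card_half : #|F| = (#|F|./2).*2.+1.
Proof. by rewrite -[LHS]odd_double_half oddF. Qed.

Let half_gt0 : (0 < #|F|./2)%N.
Proof.
have := finNzRing_gt1 F; rewrite card_half.
by case: (#|F|./2).
Qed.

(** Cancelling [x] in x^|F| = x shows that the square of [x ^+ #|F|./2] is 1. *)
Lemma expf_half (x : F) : x != 0 -> (x ^+ #|F|./2 == 1) || (x ^+ #|F|./2 == -1).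
Proof.
move=> x0; rewrite -eqf_sqr expr1n -exprM muln2.
apply/eqP/(mulfI x0); rewrite -exprS -card_half mulr1.
exact: expf_card.
Qed.

(** If -1 = 1 then 2 = 0, so the odd number |F| maps to 1 in [F]; but |F| kills the additive
    group. *)
Lemma oppr1_neq1_odd : (-1 : F) != 1.
Proof.
apply/eqP => h.
have h2 : (2%:R : F) = 0 by rewrite mulr2n -{1}h addNr.
have hc : (#|F|%:R : F) = 1.
  by rewrite card_half -muln2 -addn1 natrD natrM h2 mulr0 add0r.
have h0 : (#|F|%:R : F) = 0.
  rewrite -cardsT -FinRing.zmodXgE.
  exact: (@expg_cardG F [set: F]%G 1%R (in_setT _)).
by have := oner_neq0 F; rewrite -hc h0 eqxx.
Qed.

Lemma qchar0 : qchar 0 = 0.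
Proof. by rewrite /qchar eqxx. Qed.

Lemma qchar1 : qchar 1 = 1.
Proof. by rewrite /qchar oner_eq0 expr1n eqxx. Qed.

Lemma qcharN1 : qchar (-1) = (-1) ^+ #|F|./2.
Proof.
rewrite /qchar oppr_eq0 oner_eq0 -[in LHS]signr_odd -[in RHS]signr_odd.
by case: odd; rewrite !(expr0, expr1) ?eqxx // (negPf oppr1_neq1_odd).
Qed.

Lemma qchar_sqr x : qchar x * qchar x = (x != 0)%:R.
Proof. by rewrite /qchar; case: eqP => // _; case: eqP. Qed.

Lemma qcharM : {morph qchar : x y / x * y}.
Proof.
move=> x y; rewrite /qchar mulf_eq0.
have [->|x0] := eqVneq x 0; first by rewrite /= mul0r.
have [->|y0] := eqVneq y 0; first by rewrite /= mulr0.
rewrite exprMn.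
by case/orP: (expf_half x0) => /eqP ->; case/orP: (expf_half y0) => /eqP ->;
  rewrite ?(mulr1, mul1r, mulrNN) ?eqxx ?(negPf oppr1_neq1_odd).
Qed.

Lemma exists_nonresidue : exists2 g, g != 0 & qchar g = -1.
Proof.
have [/existsP[g /andP[g0 /eqP gN]]|/existsPn h] :=
  boolP [exists g, (g != 0) && (qchar g == -1)]; first by exists g.
(* otherwise X^m - 1, m = (#|F| - 1) / 2, would have 2m roots *)
have := @max_unity_roots F #|F|./2 (enum [pred x : F | x != 0]) half_gt0.
have -> : all (#|F|./2).-unity_root (enum [pred x : F | x != 0]).
  apply/allP => x; rewrite mem_enum inE => x0.
  apply/unity_rootP/eqP; have := h x; rewrite x0 /qchar (negPf x0) /=.
  by case: (_ == 1).
move=> /(_ isT (enum_uniq _)); rewrite -cardE.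
have := cardC1 (0 : F); rewrite [in RHS]card_half /= => ->.
by have := half_gt0; lia.
Qed.

(** Multiplication by a nonresidue permutes [F] and negates every term. *)
Lemma sum_qchar : \sum_x qchar x = 0.
Proof.
have [g g0 gN] := exists_nonresidue.
have : \sum_x qchar x = - \sum_x qchar x; last by lia.
rewrite {1}(reindex_inj (mulfI g0)) -sumrN.
by apply: eq_bigr => x _; rewrite qcharM gN mulN1r.
Qed.

Lemma qchar_autocorr a :
  \sum_x qchar (x + a) * qchar x = #|F|%:R * (a == 0)%:R - 1.
Proof.
rewrite (bigD1 0) //= qchar0 mulr0 add0r.
have [->|a0] := eqVneq a 0.
  rewrite (eq_bigr (fun=> 1)) => [|x x0]; last by rewrite addr0 qchar_sqr x0.
  rewrite sumr_const cardC1 mulr1 !natz; case: #|F| card_half => // n _; lia.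
(* chi (x + a) chi x = chi (1 + a / x), and 1 + a / x runs over all but 1 *)
have inj : injective (fun x : F => a / x).
  by move=> x y /(mulfI a0) /invr_inj.
transitivity (\sum_(x | x != 0) qchar (1 + a / x)).
  apply: eq_bigr => x x0.
  have -> : x + a = x * (1 + a / x) by rewrite mulrDr mulr1 mulrCA divff ?mulr1.
  by rewrite qcharM mulrAC qchar_sqr x0 mul1r.
transitivity (\sum_(x | x != 0) qchar (1 + x)).
  rewrite [RHS](reindex_inj inj); apply: eq_bigl => x.
  by rewrite mulf_eq0 (negPf a0) invr_eq0.
(* The full shifted sum is 0, and its term at x = 0 is 1; the other terms thus sum to -1. *)
have := sum_qchar; rewrite (reindex_inj (addrI 1)) (bigD1 0) //= addr0 qchar1.
by rewrite mulr0 sub0r => /eqP; rewrite addrC addr_eq0 => /eqP.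
Qed.

End QuadraticCharacter.

(** Joins the finite and the additive structure of a product, so that [F * K] can serve as the
    group. *)
HB.instance Definition _ (A B : finZmodType) := GRing.Zmodule.on (A * B)%type.

(** * Correlations on a finite abelian group *)

Section Correlation.

Definition corr (G : finZmodType) (g : G) (u w : G -> int) : int :=
  \sum_x u (x + g) * w x.

Definition delta (G : finZmodType) (x : G) : int := (x == 0)%:R.

(** Named so that every term of [twin_sign] is a function on [F] times a function on [K]. *)
Definition one (G : finZmodType) (x : G) : int := 1.

Variable G : finZmodType.
Implicit Types (g : G) (u w : G -> int).

Lemma corr_deltal g u : corr g (@delta G) u = u (- g).
Proof.
rewrite /corr (bigD1 (- g)) //= /delta addNr eqxx mul1r big1 ?addr0 // => x.
by rewrite -addr_eq0 => /negPf ->; rewrite mul0r.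
Qed.

Lemma corr_deltar g u : corr g u (@delta G) = u g.
Proof.
rewrite /corr (bigD1 0) //= /delta add0r eqxx mulr1 big1 ?addr0 // => x.
by move=> /negPf ->; rewrite mulr0.
Qed.

Lemma corr_onel g u : corr g (@one G) u = \sum_x u x.
Proof. by apply: eq_bigr => x _; rewrite mul1r. Qed.

Lemma corr_oner g u : corr g u (@one G) = \sum_x u x.
Proof.
rewrite [RHS](reindex_inj (addIr g)).
by apply: eq_bigr => x _; rewrite mulr1.
Qed.

Lemma sum_delta : \sum_x @delta G x = 1.
Proof. by rewrite -(corr_oner 0) corr_deltal. Qed.

Lemma sum_one : \sum_x @one G x = #|G|%:R.
Proof. by rewrite sumr_const. Qed.

Lemma deltaN g : delta (- g) = delta g.
Proof. by rewrite /delta oppr_eq0. Qed.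

End Correlation.

Lemma corr_tensor (G H : finZmodType) (g : G * H) (u u' : G -> int)
    (w w' : H -> int) :
  \sum_(x : G * H) (u (x.1 + g.1) * w (x.2 + g.2)) * (u' x.1 * w' x.2) =
  corr g.1 u u' * corr g.2 w w'.
Proof.
rewrite /corr big_distrlr /= pair_big.
by apply: eq_bigr => x _; ring.
Qed.

(** * Difference counts for the level sets of a sign function *)

Section SignFunction.
Variables (G : finZmodType) (f : G -> int).
Hypothesis f_sign : forall x, f x = 1 \/ f x = -1.

(** A pair with difference [g] is determined by its second entry [x]; the first is [x + g]. *)
Lemma count_Delta (A B : {set G}) g :
  (count_mem g (Delta A B))%:R =
  \sum_x (x + g \in A)%:R * (x \in B)%:R :> int.
Proof.
rewrite /Delta count_flatten sumnE !big_map.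
rewrite (reindex_inj (addIr (- g))) /=.
rewrite natr_sum big_enum /= [RHS](bigID [pred x | x \in A]) /=.
rewrite [X in _ + X]big1 ?addr0 => [|x /negPf xA]; last first.
  by rewrite subrK xA mul0r.
apply: eq_bigr => x xA; rewrite subrK xA mul1r count_map.
rewrite (eq_count (a2 := pred1 (x - g))) => [|y /=]; last first.
  by rewrite subr_eq eq_sym [RHS]eq_sym subr_eq addrC.
by rewrite count_uniq_mem ?enum_uniq // mem_enum.
Qed.

(** Doubling the indicator (1 + f) / 2 keeps the arithmetic in [int]. *)
Lemma two_mem_pos x : 2 * (x \in [set y | f y == 1])%:R = 1 + f x.
Proof. by rewrite inE; case: (f_sign x) => ->. Qed.

Lemma two_mem_neg x : 2 * (x \in [set y | f y == -1])%:R = 1 - f x.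
Proof. by rewrite inE; case: (f_sign x) => ->. Qed.

Lemma card_pos : 2 * #|[set x | f x == 1]|%:R = #|G|%:R + \sum_x f x.
Proof.
rewrite -sum1_card natr_sum big_mkcond mulr_sumr -(sum_one G) -big_split /=.
by apply: eq_bigr => x _; rewrite -two_mem_pos; case: (x \in _).
Qed.

Lemma card_neg : 2 * #|[set x | f x == -1]|%:R = #|G|%:R - \sum_x f x.
Proof.
rewrite -sum1_card natr_sum big_mkcond mulr_sumr -(sum_one G) -sumrB /=.
by apply: eq_bigr => x _; rewrite -two_mem_neg; case: (x \in _).
Qed.

Lemma four_count_Delta_pos_neg g :
  4 * (count_mem g (Delta [set x | f x == 1] [set x | f x == -1]))%:R =
  #|G|%:R - corr g f f.
Proof.
rewrite count_Delta mulr_sumr.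
(* The two inserted sums are equal and cancel; with them the right side is the expansion of (1 + f(x
   + g)) (1 - f x), summed over x. *)
have -> : #|G|%:R - corr g f f =
    \sum_x @one G x + corr g f (@one G) - corr g (@one G) f - corr g f f.
  by rewrite sum_one corr_oner corr_onel addrK.
rewrite -big_split -!sumrB /=; apply: eq_bigr => x _.
have -> (a b : int) : 4 * (a * b) = (2 * a) * (2 * b) by ring.
by rewrite two_mem_pos two_mem_neg /one; ring.
Qed.

Lemma four_count_Delta_neg_pos g :
  4 * (count_mem g (Delta [set x | f x == -1] [set x | f x == 1]))%:R =
  #|G|%:R - corr g f f.
Proof.
rewrite count_Delta mulr_sumr.
have -> : #|G|%:R - corr g f f =
    \sum_x @one G x - corr g f (@one G) + corr g (@one G) f - corr g f f.
  by rewrite sum_one corr_oner corr_onel subrK.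
rewrite -!sumrB -big_split -!sumrB /=; apply: eq_bigr => x _.
have -> (a b : int) : 4 * (a * b) = (2 * a) * (2 * b) by ring.
by rewrite two_mem_pos two_mem_neg /one; ring.
Qed.

End SignFunction.

(** * The twin prime power construction *)

Section TwinPrimePowers.
Variables F K : finFieldType.
Hypotheses (oddF : odd #|F|) (cardK : #|K| = (#|F| + 2)%N).

Let oddK : odd #|K|.
Proof. by rewrite cardK oddD oddF. Qed.

Definition twin_sign (x : F * K) : int :=
  qchar x.1 * qchar x.2 + one x.1 * delta x.2 - delta x.1 * one x.2
  + delta x.1 * delta x.2.

(** The character product vanishes only when a coordinate is 0; there the other terms give 1 if y =
    0 and -1 otherwise. *)
Lemma twin_signP x : twin_sign x = 1 \/ twin_sign x = -1.
Proof.
case: x => x y; rewrite /twin_sign /qchar /delta /one /=.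
case: (eqVneq x 0) => _; case: (eqVneq y 0) => _ /=;
  by do ?[case: (_ ^+ _ == _)]; do ?[by left]; right.
Qed.

(** The exponents of -1 in [qcharN1] for [F] and [K] are consecutive, so the two characters have
    opposite signs at -1. *)
Lemma qcharN_twin (a : F) (b : K) :
  qchar (- a) * qchar (- b) = - (qchar a * qchar b).
Proof.
rewrite -mulN1r -(mulN1r b) !qcharM // !qcharN1 // cardK addn2 /= exprS.
rewrite -signr_odd; case: odd; rewrite ?expr0 ?expr1; ring.
Qed.

Lemma sum_tensor (u : F -> int) (w : K -> int) :
  \sum_(x : F * K) u x.1 * w x.2 = (\sum_x u x) * (\sum_y w y).
Proof. by rewrite big_distrlr /= pair_big. Qed.

(** The character sums vanish, which leaves |F| - |K| + 1. *)
Lemma sum_twin_sign : \sum_x twin_sign x = -1.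
Proof.
rewrite !(big_split, sumrN) /= !sum_tensor !sum_delta !sum_one !sum_qchar //.
rewrite cardK natrD; ring.
Qed.

Lemma twin_sign_autocorr (g : F * K) :
  @corr (F * K)%type g twin_sign twin_sign =
  (#|F| * #|K| + 1)%:R * @delta (F * K)%type g - 1.
Proof.
pose t (u u' : F -> int) (w w' : K -> int) (x : F * K) : int :=
  (u (x.1 + g.1) * w (x.2 + g.2)) * (u' x.1 * w' x.2).
pose c := @qchar F; pose e := @qchar K.
pose d := @delta F; pose d' := @delta K; pose i := @one F; pose i' := @one K.
(* Sixteen products: rows follow the shifted factor, columns the unshifted one. *)
transitivity (\sum_x
  ((t c c e e x + t c i e d' x - t c d e i' x + t c d e d' x)
 + (t i c d' e x + t i i d' d' x - t i d d' i' x + t i d d' d' x)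
 - (t d c i' e x + t d i i' d' x - t d d i' i' x + t d d i' d' x)
 + (t d c d' e x + t d i d' d' x - t d d d' i' x + t d d d' d' x))).
  apply: eq_bigr => x _.
  by rewrite /twin_sign /t /c /e /d /d' /i /i' /=; ring.
rewrite !(big_split, sumrN) /= !corr_tensor.
rewrite !(corr_deltal, corr_deltar, corr_onel, corr_oner).
rewrite /c /e /d /d' /i /i' !sum_qchar // !sum_one !deltaN.
(* The terms at [g] and [- g] cancel. The single deltas get coefficients ±(|K| - |F| - 2) = 0. *)
rewrite qcharN_twin /corr !qchar_autocorr // cardK.
have -> : @delta (F * K)%type g = delta g.1 * delta g.2.
  by case: g @t => a b _; rewrite /delta -natrM mulnb -pair_eqE.
rewrite /one /delta !natrD natrM natrD; ring.
Qed.

Lemma twin_gsedf (v := (#|F| * #|K|)%N) :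
  gsedf2 v ((v - 1) %/ 2)%N ((v + 1) %/ 2)%N ((v + 1) %/ 4)%N ((v + 1) %/ 4)%N
    [set x | twin_sign x == 1] [set x | twin_sign x == -1].
Proof.
have cardG : #|{: F * K}| = v by rewrite card_prod.
have [m cardF] : exists m, #|F| = m.*2.+1.
  by exists #|F|./2; rewrite -[LHS]odd_double_half oddF.
have m_gt0 : (0 < m)%N.
  by have := finNzRing_gt1 F; rewrite cardF; case: (m).
(* With q = 2m + 1, v + 1 = (q + 1)^2 = 4(m + 1)^2, so all the divisions are exact. *)
have v4 : (v + 1 = 4 * (m.+1 * m.+1))%N by rewrite /v cardK cardF; lia.
have m1_gt0 : (m * m > 0)%N by rewrite muln_gt0 m_gt0.
split=> //.
- by split; lia.
- rewrite -setI_eq0; apply/eqP/setP => x; rewrite !inE.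
  by case: (twin_signP x) => ->.
- have := card_pos twin_signP; have := card_neg twin_signP.
  rewrite sum_twin_sign cardG !natz.
  move: #|[set x | twin_sign x == -1]| #|[set x | twin_sign x == 1]| => k2 k1.
  by clearbody v; clear -v4; split; lia.
move=> g g0.
have := four_count_Delta_pos_neg twin_signP g.
have := four_count_Delta_neg_pos twin_signP g.
rewrite twin_sign_autocorr /delta (negPf g0) mulr0 cardG !natz.
move: (count_mem _ _) (count_mem _ _) => n2 n1.
by clearbody v; clear -v4; split; lia.
Qed.

End TwinPrimePowers.

Local Close Scope ring_scope.

Theorem theorem4p9 (q v : nat) (hq : prime_power q) (hq2 : prime_power (q + 2))
    (oq : odd q) (oq2 : odd (q + 2)) (hv : v = q * (q + 2)) :
  exists (G : finZmodType) (D1 D2 : {set G}),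
    gsedf2 v ((v - 1) %/ 2) ((v + 1) %/ 2) ((v + 1) %/ 4) ((v + 1) %/ 4) D1 D2.
Proof.
case: hq => p [k [pr_p k_gt0 def_q]]; case: hq2 => r [l [pr_r l_gt0 def_q2]].
(* Fields of orders q and q + 2; the additive group of their product is the witness. *)
have [F _ cardF] := PrimePowerField pr_p k_gt0.
have [K _ cardK] := PrimePowerField pr_r l_gt0.
rewrite -def_q in cardF; rewrite -def_q2 in cardK.
exists (F * K)%type.
exists [set x | twin_sign x == 1]%R, [set x | twin_sign x == -1]%R.
by subst v; rewrite -cardK -cardF; apply: twin_gsedf; rewrite cardF.
Qed.
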